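(* Let $\mathcal{B}_4$ be the set of partitions $\lambda=(\lambda_1>\lambda_2>\cdots>\lambda_\ell)$ into positive parts such that for each $1\le i<\ell$: $\lambda_i-\lambda_{i+1}=2$ if $\lambda_i,\lambda_{i+1}$ are both odd; $\lambda_i-\lambda_{i+1}=4$ if they are both even; $\lambda_i-\lambda_{i+1}=3$ if they have different parity; and the smallest part $\lambda_\ell$ equals $1$ or $2$. For integers $n,h$, let $$B_4(n,h)=B_4(n,h;x,y,q)=\sum x^{o(\lambda)}y^{e(\lambda)}q^{|\lambda|},$$ the sum over all $\lambda\in\mathcal{B}_4$ with exactly $n$ parts and largest part $h$, where $o(\lambda)$ and $e(\lambda)$ denote the numbers of odd and even parts of $\lambda$. Then for all integers $n\ge1$ and $h\ge1$, $$B_4(n,2n+2h-1)=x^{n-h}y^{h}q^{n^2+h^2+2h}{n-1\brack h}_{q^2},\qquad B_4(n,2n+2h)=x^{n-h-1}y^{h+1}q^{n^2+h^2+2h+1}{n-1\brack h}_{q^2}.$$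
   Context: $|\lambda|$ is the sum of the parts. The Gaussian coefficient is ${a+b\brack b}_q=\frac{(q;q)_{a+b}}{(q;q)_a(q;q)_b}$ if $a,b\ge0$ and $0$ otherwise, where $(a;q)_n=\prod_{i=0}^{n-1}(1-aq^i)$. *)

(* Defs.v *)
From mathcomp Require Import all_boot all_order all_algebra.
From mathcomp Require Import mpoly.

Set Implicit Arguments.
Unset Strict Implicit.
Unset Printing Implicit Defensive.

Import Order.TTheory GRing.Theory Num.Theory.
Local Open Scope ring_scope.

Definition qpoch (F : fieldType) (a q : F) (n : nat) : F :=
  \prod_(i < n) (1 - a * q ^+ i).

(* [qbinom q N b] is the Gaussian coefficient with top entry [N] and bottom
   entry [b], that is [N = a + b] with [a = N - b]. *)
Definition qbinom (F : fieldType) (q : F) (N b : int) : F :=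
  if (0 <= N - b) && (0 <= b) then
    qpoch q q `|N|%N / (qpoch q q `|(N - b)%R|%N * qpoch q q `|b|%N)
  else 0.

(* The difference condition on consecutive parts [a > b]. *)
Definition B4_gap (a b : nat) : bool :=
  [&& (odd a && odd b) ==> (a - b == 2)%N,
      (~~ odd a && ~~ odd b) ==> (a - b == 4)%N
    & (odd a != odd b) ==> (a - b == 3)%N].

(* Partitions are listed in decreasing order.  The default value 0 of [last]
   rules out the empty partition, which has no smallest part. *)
Definition in_B4 (l : seq nat) : bool :=
  [&& sorted gtn l, all (leq 1%N) l, sorted B4_gap l
    & (last 0%N l == 1%N) || (last 0%N l == 2%N)].

(* A partition with [n] parts and largest part [h] is an [n]-tuple of naturals
   at most [h].  The absolute values only serve to give the sum a finite index
   type: if [n] or [h] is negative then the sum is empty. *)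
Definition B4 (F : fieldType) (n h : int) (x y q : F) : F :=
  \sum_(t : `|n|%N.-tuple 'I_(`|h|%N.+1) |
        let l := map val t in
        [&& in_B4 l, (size l)%:Z == n & (head 0%N l)%:Z == h])
    let l := map val t in
    x ^+ count odd l * y ^+ count (predC odd) l * q ^+ sumn l.

(* The field Q(x, y, q) of rational functions in three indeterminates: it
   contains Z[x, y, q] and gives a meaning to the quotient defining the Gaussian
   coefficient and to the negative exponents in the closed formulas. *)
Notation ratfun := {fraction {mpoly int[3]}}.

Definition varx : ratfun := FracField.tofrac ('X_(inord 0%N) : {mpoly int[3]}).
Definition vary : ratfun := FracField.tofrac ('X_(inord 1%N) : {mpoly int[3]}).
Definition varq : ratfun := FracField.tofrac ('X_(inord 2%N) : {mpoly int[3]}).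

(* Main.v *)
(** Below a part [a], the next part of a partition in B_4 is [a - 2] or [a - 3]
    if [a] is odd, and [a - 3] or [a - 4] if [a] is even.  Hence B_4(n, 2n+2h-1)
    and B_4(n, 2n+2h) are, up to the weight of the largest part, the same sum
    B_4(n-1, 2(n-1)+2h-1) + B_4(n-1, 2(n-1)+2(h-1)), and the closed formulas turn
    this recurrence into the q-Pascal rule for q^2.  The induction on n has to
    start from h = 0, where the second term vanishes because the largest of n
    parts is at least 2n-1. *)
Require Import Defs.
From mathcomp Require Import all_boot all_order all_algebra.
From mathcomp Require Import mpoly zify ring.

Set Implicit Arguments.
Unset Strict Implicit.
Unset Printing Implicit Defensive.

Import Order.TTheory GRing.Theory Num.Theory.
Local Open Scope ring_scope.

(* The partitions have [n.+1] parts, not [n].  Truncated subtraction is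
   harmless: the list is empty for [h = 0]. *)
Fixpoint B4_list (n h : nat) : seq (seq nat) :=
  if n is n'.+1 then
    map (cons h) (B4_list n' (h - 3) ++ B4_list n' (h - if odd h then 2%N else 4%N))
  else if (h == 1)%N || (h == 2)%N then [:: [:: h]] else [::].

(** The part at distance 3 has the parity opposite to [a], the one at distance 2 or 4 the same
    parity. As [b] is positive, equality with a truncated difference means that nothing was
    truncated. *)
Lemma B4_gapE (a b : nat) : (0 < b)%N ->
  (b < a)%N && B4_gap a b =
  (b == a - 3)%N || (b == a - if odd a then 2%N else 4%N)%N.
Proof.
rewrite /B4_gap => b0.
have oddE c : odd c = (c %% 2 == 1)%N by rewrite modn2 eqb1.
rewrite !oddE; case: eqP => ha; case: eqP => hb /=; lia.
Qed.

Lemma in_B4_cons2 (a b : nat) (l : seq nat) :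
  in_B4 [:: a, b & l] = [&& (b < a)%N, B4_gap a b & in_B4 (b :: l)].
Proof.
rewrite /in_B4 /=; case: (ltnP b a) => //= ba.
rewrite (leq_ltn_trans (leq0n b) ba) /=.
by case: (path gtn b l) => //=; case: (B4_gap a b); rewrite ?andbF.
Qed.

Lemma in_B4_head_gt0 (b : nat) (l : seq nat) : in_B4 (b :: l) -> (0 < b)%N.
Proof. by case/and4P => _ /andP[]. Qed.

Lemma mem_B4_list (n h : nat) (l : seq nat) :
  (l \in B4_list n h) = [&& in_B4 l, size l == n.+1 & head 0%N l == h].
Proof.
elim: n h l => [|n IH] h l.
  have -> : (l \in B4_list 0 h) = (l == [:: h]) && ((h == 1)%N || (h == 2)%N).
    by rewrite /=; case: ifP => _; rewrite ?inE ?andbT ?andbF.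
  case: l => [|a [|b l]]; rewrite ?eqseq_cons /= ?andbF //.
  rewrite /in_B4 /= !andbT.
  case: (a =P h) => [->|_]; rewrite ?andbF //= andbT.
  by case: h => [|[|[|]]].
case: l => [|a [|b l]]; first by apply/mapP => -[].
  rewrite /= andbF; apply/mapP => -[s]; rewrite mem_cat !IH => + [_ sE].
  by rewrite -sE.
have -> : ([:: a, b & l] \in B4_list n.+1 h) =
    (a == h) && (b :: l \in B4_list n (h - 3)
                   ++ B4_list n (h - if odd h then 2%N else 4%N)).
  apply/mapP/andP => [[s sin [-> ->]]|[/eqP-> lin]] //.
  by exists (b :: l).
rewrite mem_cat !IH in_B4_cons2 /= !eqSS.
case: (a =P h) => [->|_]; rewrite ?andbF //= andbT.
case: (boolP (in_B4 (b :: l))) => [/in_B4_head_gt0 b0|_]; last by rewrite !andbF.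
by case: (size l == n); rewrite /= ?andbF ?andbT ?B4_gapE.
Qed.

Lemma uniq_B4_list (n h : nat) : uniq (B4_list n h).
Proof.
elim: n h => [|n IH] h /=; first by case: ifP.
rewrite map_inj_uniq => [|s t [] //].
rewrite cat_uniq !IH andbT /=; apply/hasPn => s.
rewrite /= !mem_B4_list => /and3P[Bs _ /eqP hs]; rewrite !negb_and hs.
apply/orP; right; apply/orP; right.
(* The two possible heads coincide only when both subtractions truncate to 0, which a positive head
   excludes. *)
have : (0 < head 0%N s)%N by case: s Bs {hs} => //= a s /in_B4_head_gt0.
by rewrite hs; case: odd; lia.
Qed.

(** Consecutive parts differ by at least 2 and the smallest is at least 1, so [n.+1] parts force a
    largest part of at least [n.*2.+1]. *)
Lemma B4_list_nil (n h : nat) : (h <= n.*2)%N -> B4_list n h = [::].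
Proof.
elim: n h => [|n IH] h hle /=; first by case: h hle.
by rewrite !IH //; case: (odd h); lia.
Qed.

Section Generating_function.
Variables (F : fieldType) (x y q : F).

Definition weight (l : seq nat) : F :=
  x ^+ count odd l * y ^+ count (predC odd) l * q ^+ sumn l.

Definition B4_sum (n h : nat) : F := \sum_(l <- B4_list n h) weight l.

Lemma B4_sumE (n h : nat) : B4 n.+1 h x y q = B4_sum n h.
Proof.
pose f (t : n.+1.-tuple 'I_h.+1) := map val t.
pose P (t : n.+1.-tuple 'I_h.+1) :=
  [&& in_B4 (f t), (size (f t))%:Z == n.+1%:Z & (head 0%N (f t))%:Z == h].
have Lf : perm_eq (map f (filter P (index_enum _))) (B4_list n h).
  apply: uniq_perm; last 1 first.
  - move=> l; rewrite mem_B4_list; apply/mapP/and3P => [[t]|[Bl sl hl]].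
      by rewrite mem_filter => /andP[/and3P[? ? ?] _] ->.
    (* The parts decrease from [h], so [l] lifts to a tuple over ['I_h.+1]. *)
    have lh : all (geq h) l.
      case: l Bl hl {sl} => [//|a l] /and4P[+ _ _ _] /eqP /= <-.
      have gtn_trans : transitive gtn.
        by move=> b c d cb db; exact: ltn_trans db cb.
      move=> /(order_path_min gtn_trans)/sub_all-> //; first by rewrite leqnn.
      by move=> b /ltnW.
    pose s : seq 'I_h.+1 := map inord l.
    have fs : map val s = l.
      rewrite -map_comp -[RHS]map_id; apply/eq_in_map => a /(allP lh) ah /=.
      by rewrite inordK.
    have ss : size s == n.+1 by rewrite size_map.
    exists (Tuple ss); last by rewrite /f /= fs.
    by rewrite mem_filter mem_index_enum andbT /P /f /= fs Bl !eqz_nat sl.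
  - rewrite map_inj_uniq ?filter_uniq ?index_enum_uniq // => s t st.
    by apply/val_inj/(inj_map val_inj).
  - exact: uniq_B4_list.
by rewrite /B4_sum -(perm_big _ Lf) big_map big_filter.
Qed.

Lemma B4_sum_rec (n h : nat) :
  B4_sum n.+1 h = (if odd h then x else y) * q ^+ h *
    (B4_sum n (h - 3) + B4_sum n (h - if odd h then 2%N else 4%N)).
Proof.
rewrite /B4_sum /= big_map big_cat mulrDr !big_distrr /=.
by congr (_ + _); apply: eq_bigr => l _; rewrite /weight /=; case: odd;
  rewrite !add0n ?add1n !exprS ?exprD; ring.
Qed.

End Generating_function.

(** The Gaussian coefficient with top entry [n] and bottom entry [h], defined without division by
    the form of the q-Pascal rule that the recurrence for [B4_sum] produces. *)
Fixpoint gauss (F : fieldType) (p : F) (n h : nat) : F :=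
  match n, h with
  | _, 0 => 1
  | 0, _.+1 => 0
  | n'.+1, h'.+1 => p ^+ h'.+1 * gauss p n' h'.+1 + gauss p n' h'
  end.

Lemma gauss0 (F : fieldType) (p : F) (n : nat) : gauss p n 0 = 1.
Proof. by case: n. Qed.

Lemma gauss_small (F : fieldType) (p : F) (n h : nat) :
  (n < h)%N -> gauss p n h = 0.
Proof.
elim: n h => [|n IH] [|h] //= nh.
by rewrite !IH ?mulr0 ?addr0 // ltnW.
Qed.

Lemma qpochS (F : fieldType) (a q : F) (n : nat) :
  qpoch a q n.+1 = qpoch a q n * (1 - a * q ^+ n).
Proof. exact: big_ord_recr. Qed.

(** In the double induction the two Pascal terms contribute the factors p^(h+1) (1 - p^(k+1)) and 1
    - p^(h+1), which add up to the last factor 1 - p^(k+h+2) of the right-hand side. *)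
Lemma gauss_qpoch (F : fieldType) (p : F) (k h : nat) :
  gauss p (k + h) h * (qpoch p p k * qpoch p p h) = qpoch p p (k + h).
Proof.
have qpoch0 : qpoch p p 0 = 1 by exact: big_ord0.
elim: k h => [|k IHk] h.
  rewrite qpoch0 mul1r add0n; suff -> : gauss p h h = 1 by rewrite mul1r.
  by elim: h => //= h ->; rewrite gauss_small // mulr0 add0r.
elim: h => [|h IHh]; first by rewrite addn0 gauss0 qpoch0 mul1r mulr1.
rewrite addnS /= [RHS]qpochS mulrDl.
have -> : p ^+ h.+1 * gauss p (k.+1 + h) h.+1 * (qpoch p p k.+1 * qpoch p p h.+1)
    = p ^+ h.+1 * (1 - p * p ^+ k) * qpoch p p (k.+1 + h).
  by rewrite addSnnS -IHk qpochS; ring.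
have -> : gauss p (k.+1 + h) h * (qpoch p p k.+1 * qpoch p p h.+1)
    = (1 - p * p ^+ h) * qpoch p p (k.+1 + h).
  by rewrite -IHh (qpochS _ _ h); ring.
by rewrite addSn !exprS exprD; ring.
Qed.

Lemma qbinom_gauss (F : fieldType) (p : F) (n h : nat) :
  (forall m, 1 - p ^+ m.+1 != 0) -> qbinom p n h = gauss p n h.
Proof.
move=> p1; have qpoch_neq0 m : qpoch p p m != 0.
  by apply/prodf_neq0 => i _; rewrite -exprS.
rewrite /qbinom subr_ge0 lez_nat andbT; case: leqP => [hn|/gauss_small-> //].
rewrite subzn //= -[in qpoch p p n](subnK hn) -gauss_qpoch subnK // mulfK //.
by rewrite mulf_neq0.
Qed.

(* Both identities are multiplied by [x ^+ h] so that the exponents are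
   natural numbers. *)
Lemma B4_sum_gauss (F : fieldType) (x y q : F) (n h : nat) :
  x ^+ h * B4_sum x y q n (n.*2 + h.*2).+1 =
    x ^+ n.+1 * y ^+ h * q ^+ (n.+1 ^ 2 + h ^ 2 + 2 * h) * gauss (q ^+ 2) n h
  /\
  x ^+ h * B4_sum x y q n (n.*2 + h.*2).+2 =
    x ^+ n * y ^+ h.+1 * q ^+ (n.+1 ^ 2 + h ^ 2 + 2 * h + 1)
      * gauss (q ^+ 2) n h.
Proof.
elim: n h => [|n IH] h.
  case: h => [|h]; last by rewrite /B4_sum /= !big_nil !mulr0.
  by rewrite /B4_sum /= !big_seq1 /weight /= ; split; rewrite ?expr0; ring.
set m := (n.+1.*2 + h.*2)%N.
have om1 : odd m.+1 by rewrite oddS oddD !odd_double.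
have om2 : odd m.+2 = false by rewrite oddS om1.
pose U := B4_sum x y q n (n.*2 + h.*2) + B4_sum x y q n (n.*2 + h.*2).+1.
have SO : B4_sum x y q n.+1 m.+1 = x * q ^+ m.+1 * U.
  rewrite B4_sum_rec om1.
  by congr (_ * (_ + _)); congr B4_sum; rewrite /m; lia.
have SE : B4_sum x y q n.+1 m.+2 = y * q ^+ m.+2 * U.
  rewrite B4_sum_rec om2 /U addrC.
  by congr (_ * (_ + _)); congr B4_sum; rewrite /m; lia.
have UE : x ^+ h * U = x ^+ n.+1 * y ^+ h * q ^+ (n.+1 ^ 2 + h ^ 2)
    * gauss (q ^+ 2) n.+1 h.
  rewrite /U mulrDr (IH h).1; case: h {m om1 om2 U SO SE} => [|h].
    by rewrite addn0 {1}/B4_sum B4_list_nil // big_nil !gauss0 !addn0; ring.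
  have -> : (n.*2 + h.+1.*2 = (n.*2 + h.*2).+2)%N by lia.
  rewrite (exprS x h) -mulrA (IH h).2 /= -!exprM !exprD.
  (* Once the square is completed, the summands share their monomial up to q^(2(h+1)), which is the
     Pascal weight in base [q ^+ 2]. *)
  rewrite (_ : h.+1 ^ 2 = h ^ 2 + 2 * h + 1)%N; last by lia.
  by rewrite !exprD !exprS; ring.
(* The largest part is 2n + 2h + 3: its 2n + 3 completes the next square, and 2h remains. *)
have mE : (m.+1 + n.+1 ^ 2 = n.+2 ^ 2 + 2 * h)%N by rewrite /m; lia.
split.
  rewrite SO mulrCA UE.
  rewrite (_ : n.+2 ^ 2 + h ^ 2 + 2 * h = m.+1 + (n.+1 ^ 2 + h ^ 2))%N; last by lia.
  by rewrite (exprD _ m.+1) (exprS x n.+1); ring.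
rewrite SE mulrCA UE.
rewrite (_ : n.+2 ^ 2 + h ^ 2 + 2 * h + 1 = m.+2 + (n.+1 ^ 2 + h ^ 2))%N; last by lia.
by rewrite (exprD _ m.+2) (exprS y h); ring.
Qed.

(** Cancelling the nonzero [x ^+ h] brings in the integer exponents. The condition on [q] keeps the
    denominators of [qbinom] nonzero. *)
Lemma B4_closed_form (F : fieldType) (x y q : F) (n h : nat) :
  x != 0 -> (forall m, 1 - (q ^+ 2) ^+ m.+1 != 0) ->
  B4 n.+1%:Z (n.*2 + h.*2).+1%:Z x y q =
    x ^ (n.+1%:Z - h%:Z) * y ^ h%:Z * q ^ (n.+1 ^ 2 + h ^ 2 + 2 * h)%N%:Z
      * qbinom (q ^+ 2) n h
  /\
  B4 n.+1%:Z (n.*2 + h.*2).+2%:Z x y q =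
    x ^ (n%:Z - h%:Z) * y ^ h.+1%:Z * q ^ (n.+1 ^ 2 + h ^ 2 + 2 * h + 1)%N%:Z
      * qbinom (q ^+ 2) n h.
Proof.
move=> x0 q1; have xh0 : x ^+ h != 0 by rewrite expf_neq0.
have xB (m : nat) : x ^ (m%:Z - h%:Z) = x ^+ m / x ^+ h.
  by rewrite expfzDr // exprnN.
have [E1 E2] := B4_sum_gauss x y q n h.
rewrite qbinom_gauss // !B4_sumE !xB -!exprnP.
by split; apply: (mulfI xh0); rewrite ?E1 ?E2 !mulrA (mulrC (x ^+ h)) mulfK.
Qed.

Lemma tofracX_neq0 (i : 'I_3) :
  FracField.tofrac ('X_i : {mpoly int[3]}) != 0.
Proof.
(* Evaluation with all variables at 1 separates a variable from 0. *)
rewrite tofrac_eq0; apply/eqP => /(congr1 (meval (fun=> 1))).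
by rewrite mevalXU meval0.
Qed.

Lemma one_sub_varq_neq0 (m : nat) : 1 - varq ^+ m.+1 != 0.
Proof.
rewrite subr_eq0 eq_sym -tofrac1 -tofracXn tofrac_eq.
(* Evaluation at the origin sends the power of the variable to 0, but 1 to 1. *)
apply/eqP => /(congr1 (meval (fun=> 0))).
by rewrite rmorphXn /= mevalXU expr0n rmorph1.
Qed.

Theorem theorem3p3 (n h : int) (hn : 1 <= n) (hh : 1 <= h) :
  B4 n (2 * n + 2 * h - 1) varx vary varq =
    varx ^ (n - h) * vary ^ h * varq ^ (n ^+ 2 + h ^+ 2 + 2 * h)
      * qbinom (varq ^+ 2) (n - 1) h
  /\
  B4 n (2 * n + 2 * h) varx vary varq =
    varx ^ (n - h - 1) * vary ^ (h + 1) * varq ^ (n ^+ 2 + h ^+ 2 + 2 * h + 1)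
      * qbinom (varq ^+ 2) (n - 1) h.
Proof.
(* From here on [n] is the number of parts minus one, the top entry of the Gaussian coefficient. *)
case: n hn => [[|n]|n] // _; case: h hh => [h|h] // _.
have q1 m : 1 - (varq ^+ 2) ^+ m.+1 != 0.
  by rewrite -exprM mulnS; exact: one_sub_varq_neq0.
have -> : n.+1%:Z - 1 = n by lia.
have -> : 2 * n.+1%:Z + 2 * h%:Z - 1 = (n.*2 + h.*2).+1 by lia.
have -> : 2 * n.+1%:Z + 2 * h%:Z = (n.*2 + h.*2).+2 by lia.
have -> : n.+1%:Z ^+ 2 + h%:Z ^+ 2 + 2 * h%:Z = (n.+1 ^ 2 + h ^ 2 + 2 * h)%N by lia.
have -> : n.+1%:Z - h%:Z - 1 = n%:Z - h%:Z by lia.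
have -> : h%:Z + 1 = h.+1 by lia.
rewrite -PoszD.
exact: B4_closed_form (tofracX_neq0 _) q1.
Qed.
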